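(* Let $\mathscr{M}=\{m_n\}_{n\in\mathbb{N}_0}$ be a weight sequence and let $R,S\in\mathbb{N}$ with $R+S=N$. Given $\varphi\in\mathcal{E}_{\mathscr{M}}(\mathbb{T}^N)$, there exist $C,h,\delta>0$ such that $$|\partial_t^\alpha\widehat\varphi(t,\eta)|\le C\cdot h^{|\alpha|}\cdot m_{|\alpha|}\cdot|\alpha|!\cdot\left(\inf_{p\in\mathbb{N}_0}\frac{m_p\cdot p!}{\delta^p(1+|\eta|)^p}\right),\qquad\forall t\in\mathbb{T}^R,\ \forall\alpha\in\mathbb{N}_0^R,\ \forall\eta\in\mathbb{Z}^S.$$
   Context: $\mathbb{N}=\{1,2,\dots\}$, $\mathbb{N}_0=\mathbb{N}\cup\{0\}$, $\mathbb{T}^N=\mathbb{R}^N/2\pi\mathbb{Z}^N$, and $|\eta|$ is the Euclidean norm of $\eta\in\mathbb{Z}^S$. A weight sequence is a sequence $\mathscr{M}=\{m_n\}_{n\in\mathbb{N}_0}$ of positive reals with: $m_0=m_1=1$; $m_n^2\le m_{n-1}m_{n+1}$ for all $n\in\mathbb{N}$; and there is $H>1$ with $m_{j+k}\le H^{j+k}m_jm_k$ for all $j,k\in\mathbb{N}_0$. $\mathcal{E}_{\mathscr{M}}(\mathbb{T}^N)$ is the space of $f\in C^\infty(\mathbb{T}^N)$ (complex-valued) for which there are $C,h>0$ with $|D^\alpha f(x)|\le C h^{|\alpha|}m_{|\alpha|}|\alpha|!$ for all $x\in\mathbb{T}^N$, $\alpha\in\mathbb{N}_0^N$, where $D=-i\partial$.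 Points of $\mathbb{T}^N$ are written $(t,x)$ with $t\in\mathbb{T}^R$, $x\in\mathbb{T}^S$. The partial Fourier coefficients of $\varphi$ are $\widehat\varphi(t,\eta)=\frac{1}{(2\pi)^S}\int_{\mathbb{T}^S}\varphi(t,x)e^{-ix\eta}\,dx$ for $t\in\mathbb{T}^R$, $\eta\in\mathbb{Z}^S$. *)

(* Defs.v *)
From Stdlib Require Import Reals.
From Coquelicot Require Import Coquelicot.
From mathcomp Require Import all_boot.

Set Implicit Arguments.
Unset Strict Implicit.
Unset Printing Implicit Defensive.

Local Open Scope R_scope.

Record weight_sequence (m : nat -> R) : Prop := WeightSequence {
  weight_gt0 : forall n, 0 < m n;
  weight0 : m 0%N = 1;
  weight1 : m 1%N = 1;
  weight_logconvex : forall n : nat, (1 <= n)%N -> m n ^ 2 <= m n.-1 * m n.+1;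
  weight_moderate : exists H : R, 1 < H /\
    forall j k : nat, m (j + k)%N <= H ^ (j + k)%N * m j * m k
}.

(* A function on the torus (R / 2 pi Z)^n is represented by a 2 pi-periodic
   function on R^n.  The function space below carries Coquelicot's uniform
   structure, which for the finite index type 'I_n is that of the sup norm. *)
Definition vec (n : nat) : UniformSpace := fct_UniformSpace 'I_n R_UniformSpace.

Definition upd (n : nat) (x : vec n) (i : 'I_n) (u : R) : vec n :=
  fun j => if j == i then u else x j.

Definition ex_pderiv (n : nat) (i : 'I_n) (f : vec n -> C) (x : vec n) : Prop :=
  ex_derive (K := R_AbsRing) (V := C_R_NormedModule)
    (fun u : R => f (upd x i u)) (x i).

Definition pderiv (n : nat) (i : 'I_n) (f : vec n -> C) (x : vec n) : C :=
  (Derive (fun u : R => Re (f (upd x i u))) (x i),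
   Derive (fun u : R => Im (f (upd x i u))) (x i)).

Fixpoint Ck (n k : nat) (f : vec n -> C) : Prop :=
  (forall x : vec n, continuous (T := vec n) (U := C_UniformSpace) f x) /\
  match k with
  | 0%N => True
  | k'.+1 => forall i : 'I_n,
      (forall x : vec n, ex_pderiv i f x) /\ Ck k' (pderiv i f)
  end.

Definition periodic (n : nat) (f : vec n -> C) : Prop :=
  forall (i : 'I_n) (x : vec n), f (upd x i (x i + 2 * PI)) = f x.

Definition smooth_torus (n : nat) (f : vec n -> C) : Prop :=
  periodic f /\ forall k : nat, Ck k f.

Definition mlen (n : nat) (a : 'I_n -> nat) : nat := (\sum_(i < n) a i)%N.

Definition mderiv (n : nat) (a : 'I_n -> nat) (f : vec n -> C) : vec n -> C :=
  foldr (fun (i : 'I_n) (g : vec n -> C) => iter (a i) (pderiv i) g) f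
    (enum 'I_n).

(* D^a with the normalization D = - i d. *)
Definition mD (n : nat) (a : 'I_n -> nat) (f : vec n -> C) (x : vec n) : C :=
  (Cpow (- Ci) (mlen a) * mderiv a f x)%C.

Definition E_class (m : nat -> R) (n : nat) (f : vec n -> C) : Prop :=
  smooth_torus f /\
  exists C0 h : R, 0 < C0 /\ 0 < h /\
    forall (x : vec n) (a : 'I_n -> nat),
      Cmod (mD a f x) <= C0 * h ^ mlen a * m (mlen a) * INR (mlen a)`!.

Definition vcons (n : nat) (u : R) (x : vec n) : vec n.+1 :=
  fun i => if unlift ord0 i is Some j then x j else u.

Definition vjoin (r s : nat) (t : vec r) (x : vec s) : vec (r + s) :=
  fun i => match split i with inl j => t j | inr k => x k end.

(* Integral over [0, 2 pi]^n, as an iterated Riemann integral; it is applied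
   to continuous functions only. *)
Fixpoint torus_int (n : nat) : (vec n -> C) -> C :=
  match n return (vec n -> C) -> C with
  | 0%N => fun f => f (fun _ => 0)
  | n'.+1 => fun f =>
      RInt (V := C_R_CompleteNormedModule)
        (fun u : R => torus_int (fun x : vec n' => f (vcons u x))) 0 (2 * PI)
  end.

Definition expi (u : R) : C := (cos u, sin u).

Definition dot (n : nat) (x : vec n) (eta : 'I_n -> Z) : R :=
  \big[Rplus/0]_(i < n) (x i * IZR (eta i)).

Definition enorm (n : nat) (eta : 'I_n -> Z) : R :=
  sqrt (\big[Rplus/0]_(i < n) (IZR (eta i) ^ 2)).

Definition fourier (r s : nat) (phi : vec (r + s) -> C)
    (t : vec r) (eta : 'I_s -> Z) : C :=
  (RtoC (/ (2 * PI) ^ s) *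
   torus_int (fun x : vec s => phi (vjoin t x) * expi (- dot x eta)))%C.

(* Main.v *)
Require Import Defs.
From HB Require Import structures.
From Stdlib Require Import ZArith Reals Lra Lia.
From Stdlib Require Import FunctionalExtensionality Classical ClassicalEpsilon.
From Coquelicot Require Import Coquelicot.
From mathcomp Require Import all_boot.

(** The estimate is integration by parts, with the number of integrations left
    free.  Choose a coordinate k in which eta is largest in absolute value.
    Integrating by parts p times in x_k gives

      (i eta_k)^p phi^(t, eta) = (d_{x_k}^p phi)^(t, eta)

    because the boundary terms cancel by periodicity
    ([fourier_iter_pderiv_r]).  Derivatives in t pass under the integral
    ([is_pderiv_fourier]), and averaging over the torus does not increase the
    supremum ([fourier_le]).  Hence |eta_k|^p |d_t^a phi^(t, eta)| is at most
    the supremum of |d_t^a d_{x_k}^p phi| ([mderiv_fourier_le]).  The hypothesis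
    on phi bounds this supremum by C h^n m_n n! with n = |a| + p.

    Moderate growth and the binomial bound (a + p)! <= 2^(a + p) a! p! split
    that number into a factor depending on |a| and the factor
    (2 h H)^p m_p p!.  Since |eta_k| is comparable to 1 + |eta| for nonzero eta
    ([enorm_le]), dividing by |eta_k|^p yields the p-th term of the infimum,
    for every p.  For eta = 0 the case p = 0 suffices: the weights are at least
    1, so every term of the infimum is at least 1 as soon as delta <= 1.

    The t-derivatives are taken after the integrations by parts, so the mixed
    derivative that appears has the t-derivatives outermost.  This is the order
    in which [mderiv] composes partial derivatives, and so derivatives never
    have to be exchanged.

    The analysis behind this is continuity and differentiability of the iterated
    integral with respect to parameters ([cont_torus_int], [der_torus_int]);
    both go by induction on the number of integrations, from the
    one-dimensional statements [cont_CInt] and [der_CInt]. *)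

Set Implicit Arguments.
Unset Strict Implicit.
Unset Printing Implicit Defensive.

Local Open Scope R_scope.

(** * Calculus of complex-valued functions *)

Definition cont (T : UniformSpace) (f : T -> C) : Prop :=
  forall x, continuous (T := T) (U := C_UniformSpace) f x.

Definition der (f : R -> C) (x : R) (l : C) : Prop :=
  is_derive (K := R_AbsRing) (V := C_R_NormedModule) f x l.

Lemma continuous_ReIm (T : UniformSpace) (f : T -> C) (x : T) :
  continuous (U := C_UniformSpace) f x <->
  continuous (fun y => Re (f y)) x /\ continuous (fun y => Im (f y)) x.
Proof.
split.
- move=> h; split.
  + apply: (continuous_comp f fst) => //.
    exact: (@continuous_fst R_UniformSpace R_UniformSpace).
  + apply: (continuous_comp f snd) => //.
    exact: (@continuous_snd R_UniformSpace R_UniformSpace).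
- move=> [h1 h2] P [e he].
  have k1 : locally x (fun y => ball (Re (f x)) e (Re (f y))).
    exact: (h1 _ (locally_ball _ e)).
  have k2 : locally x (fun y => ball (Im (f x)) e (Im (f y))).
    exact: (h2 _ (locally_ball _ e)).
  rewrite /filtermap.
  by apply: filter_imp (filter_and _ _ k1 k2) => y [a b]; apply: he; split.
Qed.

Lemma der_ReIm (f : R -> C) x l : der f x l <->
  is_derive (fun y => Re (f y)) x (Re l) /\ is_derive (fun y => Im (f y)) x (Im l).
Proof.
split.
- move=> h; split.
  + apply: (filterdiff_comp' (V := C_R_NormedModule) (W := R_NormedModule)
      f Re x _ Re h).
    apply: filterdiff_linear; exact: (@is_linear_fst _ R_NormedModule R_NormedModule).
  + apply: (filterdiff_comp' (V := C_R_NormedModule) (W := R_NormedModule)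
      f Im x _ Im h).
    apply: filterdiff_linear; exact: (@is_linear_snd _ R_NormedModule R_NormedModule).
- move=> [h1 h2].
  apply: (filterdiff_ext (fun y : R => (Re (f y), Im (f y)) : C_R_NormedModule)).
    by move=> y; case: (f y).
  apply: (filterdiff_comp'_2 (U := R_NormedModule) (V := R_NormedModule)
    (W := C_R_NormedModule) (fun y => Re (f y)) (fun y => Im (f y)) (fun a b => (a, b))
    x (fun y => scal y (Re l)) (fun y => scal y (Im l)) (fun a b => (a, b)) h1 h2).
  apply: (filterdiff_ext (fun z : R * R => z)); first by case.
  have := filterdiff_id (V := C_R_NormedModule) (locally (Re (f x), Im (f x))).
  by move=> h; apply: (filterdiff_ext_lin _ _ _ h); case.
Qed.

Lemma cont_mult (T : UniformSpace) (f g : T -> C) :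
  cont f -> cont g -> cont (fun x => (f x * g x)%C).
Proof.
move=> hf hg x.
have [f1 f2] := (continuous_ReIm f x).1 (hf x).
have [g1 g2] := (continuous_ReIm g x).1 (hg x).
apply/continuous_ReIm; split.
- apply: (continuous_minus (V := R_NormedModule)); exact: (continuous_mult (K := R_AbsRing)).
- apply: (continuous_plus (V := R_NormedModule)); exact: (continuous_mult (K := R_AbsRing)).
Qed.

Lemma cont_plus (T : UniformSpace) (f g : T -> C) :
  cont f -> cont g -> cont (fun x => (f x + g x)%C).
Proof.
by move=> hf hg x; apply: (continuous_plus (V := C_R_NormedModule)); [exact: hf|exact: hg].
Qed.

Lemma cont_const (T : UniformSpace) (c : C) : cont (fun _ : T => c).
Proof. move=> x; exact: continuous_const. Qed.

Lemma cont_comp (T U : UniformSpace) (f : T -> U) (g : U -> C) :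
  (forall x, continuous f x) -> cont g -> cont (fun x => g (f x)).
Proof. by move=> hf hg x; apply: continuous_comp. Qed.

Lemma der_mult (f g : R -> C) x l k : der f x l -> der g x k ->
  der (fun y => (f y * g y)%C) x (l * g x + f x * k)%C.
Proof.
move=> /der_ReIm [f1 f2] /der_ReIm [g1 g2].
apply/der_ReIm; split.
- have h1 := is_derive_mult _ _ _ _ _ f1 g1 Rmult_comm.
  have h2 := is_derive_mult _ _ _ _ _ f2 g2 Rmult_comm.
  have h := is_derive_minus _ _ _ _ _ h1 h2.
  apply: (is_derive_ext _ _ _ _ _ (eq_ind _ (fun z => is_derive _ x z) h _ _)) => //.
  rewrite /minus /plus /opp /mult /= /Re /Im /=; ring.
- have h1 := is_derive_mult _ _ _ _ _ f1 g2 Rmult_comm.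
  have h2 := is_derive_mult _ _ _ _ _ f2 g1 Rmult_comm.
  have h := is_derive_plus _ _ _ _ _ h1 h2.
  apply: (is_derive_ext _ _ _ _ _ (eq_ind _ (fun z => is_derive _ x z) h _ _)) => //.
  rewrite /minus /plus /opp /mult /= /Re /Im /=; ring.
Qed.

Lemma is_RInt_ReIm (f : R -> C) a b l :
  is_RInt (V := C_R_NormedModule) f a b l <->
  is_RInt (fun u => Re (f u)) a b (Re l) /\ is_RInt (fun u => Im (f u)) a b (Im l).
Proof.
split.
- move=> h; split.
    exact: (is_RInt_fct_extend_fst (U := R_NormedModule) (V := R_NormedModule) f a b l h).
  exact: (is_RInt_fct_extend_snd (U := R_NormedModule) (V := R_NormedModule) f a b l h).
- case: l => l1 l2 [h1 h2].
  exact: (is_RInt_fct_extend_pair (U := R_NormedModule) (V := R_NormedModule) f a b).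
Qed.

Local Notation CInt := (RInt (V := C_R_CompleteNormedModule)).

Lemma is_CInt (f : R -> C) a b : cont f ->
  is_RInt (V := C_R_NormedModule) f a b (CInt f a b).
Proof.
move=> hf; apply: (RInt_correct (V := C_R_CompleteNormedModule)).
apply: (ex_RInt_continuous (V := C_R_CompleteNormedModule)) => z _; exact: hf.
Qed.

Arguments is_CInt f a b : clear implicits.

Lemma norm_C (z : C) : norm (z : C_R_NormedModule) = Cmod z.
Proof.
case: z => a b; rewrite /norm /= /prod_norm /Cmod /norm /= /abs /=.
congr sqrt.
by rewrite !Rmult_1_r -!Rabs_mult !Rabs_pos_eq //; apply: Rle_0_sqr.
Qed.

Lemma CInt_le (f : R -> C) a b M : a <= b -> cont f ->
  (forall u, Cmod (f u) <= M) -> Cmod (CInt f a b) <= (b - a) * M.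
Proof.
move=> ab hf hM; rewrite -norm_C.
apply: (norm_RInt_le_const (V := C_R_NormedModule) f) => //; last exact: is_CInt.
by move=> x _; rewrite norm_C.
Qed.

Lemma CInt_plus (f g : R -> C) a b : cont f -> cont g ->
  CInt (fun u => (f u + g u)%C) a b = (CInt f a b + CInt g a b)%C.
Proof.
move=> hf hg; apply: (is_RInt_unique (V := C_R_CompleteNormedModule)).
have h := is_RInt_plus (V := C_R_NormedModule) f g _ _ _ _ (is_CInt _ a b hf) (is_CInt _ a b hg).
exact: h.
Qed.

Lemma CInt_scal (c : C) (f : R -> C) a b : cont f ->
  CInt (fun u => (c * f u)%C) a b = (c * CInt f a b)%C.
Proof.
move=> hf; apply: (is_RInt_unique (V := C_R_CompleteNormedModule)).
have [h1 h2] := (is_RInt_ReIm f a b _).1 (is_CInt _ a b hf).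
apply/is_RInt_ReIm; split.
- exact: (is_RInt_minus _ _ _ _ _ _ (is_RInt_scal _ _ _ (Re c) _ h1)
                                   (is_RInt_scal _ _ _ (Im c) _ h2)).
- exact: (is_RInt_plus _ _ _ _ _ _ (is_RInt_scal _ _ _ (Re c) _ h2)
                                   (is_RInt_scal _ _ _ (Im c) _ h1)).
Qed.

Lemma continuous_Cmod (T : UniformSpace) (f : T -> C) (x : T) :
  continuous (U := C_UniformSpace) f x <->
  forall e : posreal, locally x (fun y => Cmod (f y - f x)%C < e).
Proof.
have F := @filterlim_locally_ball_norm _ _ C_R_NormedModule _
  (@filter_filter _ _ (locally_filter x)) f (f x).
split=> h.
- move=> e; refine (filter_imp _ _ _ (F.1 h e)) => y.
  by rewrite -norm_C.
- apply/F => e.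
  refine (filter_imp _ _ _ (h e)) => y; by rewrite -norm_C.
Qed.

Lemma cont_slice (T : UniformSpace) (g : T * R -> C) (t : T) :
  cont g -> cont (fun u => g (t, u)).
Proof.
move=> hg; apply: cont_comp hg => u.
apply: (continuous_comp_2 (fun _ : R => t) (fun u : R => u) (fun t u => (t, u))).
- exact: continuous_const.
- exact: continuous_id.
- apply: (continuous_ext (fun z => z)); first by case.
  exact: continuous_id.
Qed.

(** A tube lemma: the balls around the points (t0, u) on which g varies
    little cover {t0} x [a, b], and compactness of [a, b] extracts a common
    radius in the direction of t. *)
Lemma uniform_slice (T : UniformSpace) (g : T * R -> C) (a b : R) (t0 : T)
    (e : posreal) : cont g ->
  locally t0 (fun t => forall u, a <= u <= b -> Cmod (g (t, u) - g (t0, u))%C < e).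
Proof.
move=> hg.
have e2 : 0 < e / 2 by case: e => e /= ?; lra.
have hd u : exists d : posreal, forall t v, ball t0 d t -> Rabs (v - u) < d ->
    Cmod (g (t, v) - g (t0, u))%C < e / 2.
  have [d hd] := (continuous_Cmod g (t0, u)).1 (hg (t0, u)) (mkposreal _ e2).
  by exists d => t v bt bv; apply: (hd (t, v)); split.
pose delta u := proj1_sig (constructive_indefinite_description _ (hd u)).
have hdelta u : forall t v, ball t0 (delta u) t -> Rabs (v - u) < delta u ->
    Cmod (g (t, v) - g (t0, u))%C < e / 2.
  exact: (proj2_sig (constructive_indefinite_description _ (hd u))).
have [d hcomp] := compactness_value_1d a b delta.
exists d => t bt u hu.
have [v [hv [huv hdv]]] := NNPP _ (hcomp u hu).
have bt' : ball t0 (delta v) t by apply: ball_le bt.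
have -> : (g (t, u) - g (t0, u))%C =
  ((g (t, u) - g (t0, v)) - (g (t0, u) - g (t0, v)))%C by ring.
apply: Rle_lt_trans (Cmod_triangle _ _) _.
rewrite Cmod_opp.
have h1 := hdelta v t u bt' huv.
have h2 := hdelta v t0 u (ball_center _ _) huv.
lra.
Qed.

(** The integrands converge uniformly on [a, b] by [uniform_slice], hence so
    do the integrals. *)
Lemma cont_CInt (T : UniformSpace) (g : T * R -> C) a b : a <= b ->
  cont g -> cont (fun t => CInt (fun u => g (t, u)) a b).
Proof.
move=> ab hg t0; apply/continuous_Cmod => e.
have e' : 0 < e / (b - a + 1) by apply: Rdiv_lt_0_compat; [case: e|lra].
move: (uniform_slice a b t0 (mkposreal _ e') hg); apply: filter_imp => t ht.
have -> : (CInt (fun u => g (t, u)) a b - CInt (fun u => g (t0, u)) a b)%C =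
    CInt (fun u => minus (g (t, u) : C_R_NormedModule) (g (t0, u))) a b.
  symmetry; apply: (is_RInt_unique (V := C_R_CompleteNormedModule)).
  apply: (is_RInt_minus (V := C_R_NormedModule)); apply: is_CInt; exact: cont_slice.
rewrite -norm_C.
apply: (Rle_lt_trans _ ((b - a) * (e / (b - a + 1)))).
  apply: (norm_RInt_le_const (V := C_R_NormedModule)
    (fun u => minus (g (t, u) : C_R_NormedModule) (g (t0, u)))) => //.
    by move=> u hu; rewrite norm_C; apply: Rlt_le; apply: ht.
  apply: (RInt_correct (V := C_R_CompleteNormedModule)).
  eexists; apply: (is_RInt_minus (V := C_R_NormedModule)); apply: is_CInt; exact: cont_slice.
have -> : (b - a) * (e / (b - a + 1)) = e - e / (b - a + 1) by field; lra.
lra.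
Qed.

(** Differentiation under the integral sign, applied to the real and the
    imaginary part p of f. *)
Lemma der_CInt (f df : R * R -> C) a b :
  cont f -> cont df ->
  (forall v u, der (fun v' => f (v', u)) v (df (v, u))) ->
  forall v, der (fun v' => CInt (fun u => f (v', u)) a b) v
                (CInt (fun u => df (v, u)) a b).
Proof.
move=> hf hdf hd v.
have key (p : C -> R) :
    (forall (T : UniformSpace) (h : T -> C) x, continuous (U := C_UniformSpace) h x ->
       continuous (fun y => p (h y)) x) ->
    (forall h l x, der h x l -> is_derive (fun y => p (h y)) x (p l)) ->
    (forall h l, is_RInt (V := C_R_NormedModule) h a b l ->
       is_RInt (fun y => p (h y)) a b (p l)) ->
    is_derive (fun v' => p (CInt (fun u => f (v', u)) a b)) v
      (p (CInt (fun u => df (v, u)) a b)).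
  move=> pc pd pI.
  have pI' h : cont h -> RInt (fun y => p (h y)) a b = p (CInt h a b).
    by move=> hh; apply: is_RInt_unique; apply/pI/is_CInt.
  have pD w u : Derive (fun z => p (f (z, u))) w = p (df (w, u)).
    by apply: is_derive_unique; apply: (pd (fun z => f (z, u))); apply: hd.
  apply: (is_derive_ext (fun v' => RInt (fun u => p (f (v', u))) a b)).
    by move=> w; apply: (pI' (fun u => f (w, u))); exact: cont_slice.
  rewrite -(pI' (fun u => df (v, u))); last exact: cont_slice.
  rewrite -(RInt_ext (fun t => Derive (fun u => p (f (u, t))) v)); last by move=> u _.
  apply: (is_derive_RInt_param (fun v' u => p (f (v', u)))).
  - exists (mkposreal 1 Rlt_0_1) => w _ u _; exists (p (df (w, u))).
    by apply: (pd (fun z => f (z, u))); apply: hd.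
  - move=> u _; apply: (continuity_2d_pt_ext (fun w u => p (df (w, u)))) => //.
    apply/continuity_2d_pt_filterlim.
    apply: (continuous_ext (fun z : R * R => p (df z))); first by case.
    exact: pc.
  - exists (mkposreal 1 Rlt_0_1) => w _; exists (p (CInt (fun u => f (w, u)) a b)).
    by apply: (pI (fun u => f (w, u))); apply: is_CInt; exact: cont_slice.
apply/der_ReIm; split; apply: key.
- by move=> T h x /continuous_ReIm [].
- by move=> h l x /der_ReIm [].
- by move=> h l /is_RInt_ReIm [].
- by move=> T h x /continuous_ReIm [].
- by move=> h l x /der_ReIm [].
- by move=> h l /is_RInt_ReIm [].
Qed.

(** * The iterated integral over the torus *)

Lemma continuous_pair (T U V : UniformSpace) (f : T -> U) (g : T -> V) x :
  continuous f x -> continuous g x -> continuous (fun y => (f y, g y)) x.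
Proof.
move=> hf hg; apply: (continuous_comp_2 f g (fun a b => (a, b))) => //.
apply: (continuous_ext (fun z => z)); first by case.
exact: continuous_id.
Qed.

(** A uniform estimate in finitely many coordinates is a finite intersection
    of neighbourhoods. *)
Lemma continuous_vec (T : UniformSpace) n (f : T -> vec n) t :
  (forall i, continuous (fun x => f x i) t) -> continuous (U := vec n) f t.
Proof.
move=> h; apply/filterlim_locally => e.
have hs (s : seq 'I_n) : locally t (fun y => forall i, i \in s -> ball (f t i) e (f y i)).
  elim: s => [|i s IH]; first exact: filter_forall.
  have hi := (@filterlim_locally _ _ _ (@filter_filter _ _ (locally_filter t)) _ _).1 (h i) e.
  apply: filter_imp (filter_and _ _ hi IH) => y [h1 h2] j.
  by rewrite inE => /orP [/eqP ->|/h2].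
apply: filter_imp (hs (enum 'I_n)) => y hy i; apply: hy; exact: mem_enum.
Qed.

Lemma continuous_coord n (i : 'I_n) (x : vec n) :
  continuous (fun y : vec n => y i) x.
Proof. by apply/filterlim_locally => e; exists e => y; apply. Qed.

Lemma cont_pair (T U V : UniformSpace) (f : T -> U) (g : T -> V) (h : U * V -> C) :
  (forall x, continuous f x) -> (forall x, continuous g x) -> cont h ->
  cont (fun x => h (f x, g x)).
Proof. by move=> hf hg hh; apply: cont_comp hh => x; apply: continuous_pair. Qed.

Lemma continuous_vcons (T : UniformSpace) n (f : T -> R) (g : T -> vec n) t :
  continuous f t -> continuous g t ->
  continuous (U := vec n.+1) (fun y => vcons (f y) (g y)) t.
Proof.
move=> hf hg; apply: continuous_vec => i; rewrite /vcons.
case: (unlift ord0 i) => [j|//].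
apply: (continuous_comp g (fun x : vec n => x j)) => //; exact: continuous_coord.
Qed.

Lemma continuous_vjoin (T : UniformSpace) r s (f : T -> vec r) (g : T -> vec s) t :
  continuous f t -> continuous g t ->
  continuous (U := vec (r + s)) (fun y => vjoin (f y) (g y)) t.
Proof.
move=> hf hg; apply: continuous_vec => i; rewrite /vjoin.
case: (split i) => j.
  apply: (continuous_comp f (fun x : vec r => x j)) => //; exact: continuous_coord.
apply: (continuous_comp g (fun x : vec s => x j)) => //; exact: continuous_coord.
Qed.

Lemma continuous_upd (T : UniformSpace) n (i : 'I_n) (f : T -> vec n) (g : T -> R) t :
  continuous f t -> continuous g t ->
  continuous (U := vec n) (fun y => upd (f y) i (g y)) t.
Proof.
move=> hf hg; apply: continuous_vec => j; rewrite /upd; case: (j == i) => //.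
apply: (continuous_comp f (fun x : vec n => x j)) => //; exact: continuous_coord.
Qed.

Lemma twoPI_ge0 : 0 <= 2 * PI.
Proof. by have := PI_RGT_0; lra. Qed.

(** Induction on n: the outermost integration variable becomes a parameter of
    the inner integral, so the parameter space grows from T to T * R.  This is
    why T is arbitrary and continuity is joint. *)
Lemma cont_torus_int n (T : UniformSpace) (F : T * vec n -> C) :
  cont F -> cont (fun t => torus_int (fun x => F (t, x))).
Proof.
elim: n T F => [|n IH] T F hF /=.
  apply: (cont_pair _ _ hF) => x; [exact: continuous_id|exact: continuous_const].
apply: (cont_CInt (g := fun p : T * R => torus_int (fun x => F (p.1, vcons p.2 x)))).
  exact: twoPI_ge0.
apply: (IH _ (fun q : (T * R) * vec n => F (q.1.1, vcons q.1.2 q.2))).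
apply: cont_pair hF => q.
  apply: continuous_comp; exact: continuous_fst.
apply: continuous_vcons; last exact: continuous_snd.
apply: continuous_comp; [exact: continuous_fst|exact: continuous_snd].
Qed.

Lemma cont_vcons n (f : vec n.+1 -> C) :
  cont f -> cont (fun q : R * vec n => f (vcons q.1 q.2)).
Proof.
move=> hf; apply: cont_comp hf => q.
apply: continuous_vcons; [exact: continuous_fst|exact: continuous_snd].
Qed.

Lemma cont_vcons_r n (f : vec n.+1 -> C) u :
  cont f -> cont (fun x : vec n => f (vcons u x)).
Proof.
move=> hf; apply: cont_comp hf => q.
apply: continuous_vcons; [exact: continuous_const|exact: continuous_id].
Qed.

Lemma cont_torus_int_vcons n (f : vec n.+1 -> C) : cont f ->
  cont (fun u => torus_int (fun x : vec n => f (vcons u x))).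
Proof.
move=> hf; exact: (cont_torus_int (F := fun q => f (vcons q.1 q.2)) (cont_vcons hf)).
Qed.

Lemma der_torus_int n (F dF : R * vec n -> C) : cont F -> cont dF ->
  (forall v x, der (fun w => F (w, x)) v (dF (v, x))) ->
  forall v, der (fun w => torus_int (fun x => F (w, x))) v
                (torus_int (fun x => dF (v, x))).
Proof.
elim: n F dF => [|n IH] F dF hF hdF hd v /=; first exact: hd.
have hc (G : R * vec n.+1 -> C) : cont G ->
    cont (fun q : (R * R) * vec n => G (q.1.1, vcons q.1.2 q.2)).
  move=> hG; apply: cont_pair hG => q.
    apply: continuous_comp; exact: continuous_fst.
  apply: continuous_vcons; last exact: continuous_snd.
  apply: continuous_comp; [exact: continuous_fst|exact: continuous_snd].
apply: (der_CInt (f := fun p : R * R => torus_int (fun x => F (p.1, vcons p.2 x)))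
  (df := fun p : R * R => torus_int (fun x => dF (p.1, vcons p.2 x)))).
- exact: (cont_torus_int (hc _ hF)).
- exact: (cont_torus_int (hc _ hdF)).
- move=> w u.
  have hc' (G : R * vec n.+1 -> C) : cont G ->
      cont (fun q : R * vec n => G (q.1, vcons u q.2)).
    move=> hG; apply: cont_pair hG => q; first exact: continuous_fst.
    apply: continuous_vcons; [exact: continuous_const|exact: continuous_snd].
  apply: (IH (fun q => F (q.1, vcons u q.2)) (fun q => dF (q.1, vcons u q.2))).
  + exact: hc'.
  + exact: hc'.
  + by move=> z x; apply: hd.
Qed.

Lemma torus_int_le n (f : vec n -> C) M : cont f -> (forall x, Cmod (f x) <= M) ->
  Cmod (torus_int f) <= (2 * PI) ^ n * M.
Proof.
elim: n f => [|n IH] f hf hM /=.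
  by rewrite Rmult_1_l.
have -> : 2 * PI * (2 * PI) ^ n * M = (2 * PI - 0) * ((2 * PI) ^ n * M) by ring.
apply: CInt_le; first exact: twoPI_ge0.
  exact: cont_torus_int_vcons.
by move=> u; apply: IH => //; exact: cont_vcons_r.
Qed.

Lemma torus_int_plus n (f g : vec n -> C) : cont f -> cont g ->
  torus_int (fun x => (f x + g x)%C) = (torus_int f + torus_int g)%C.
Proof.
elim: n f g => [|n IH] f g hf hg //=.
rewrite -CInt_plus; try exact: cont_torus_int_vcons.
congr (CInt _ 0 (2 * PI)); apply: functional_extensionality => u.
by apply: IH; exact: cont_vcons_r.
Qed.

Lemma torus_int_scal n c (f : vec n -> C) : cont f ->
  torus_int (fun x => (c * f x)%C) = (c * torus_int f)%C.
Proof.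
elim: n f => [|n IH] f hf //=.
rewrite -CInt_scal; last exact: cont_torus_int_vcons.
congr (CInt _ 0 (2 * PI)); apply: functional_extensionality => u.
by apply: IH; exact: cont_vcons_r.
Qed.

(** A relational form of [pderiv], which speaks of existence and value at once
    and so composes under the rules of differentiation. *)
Definition is_pderiv n (i : 'I_n) (f f' : vec n -> C) : Prop :=
  forall x, der (fun u => f (upd x i u)) (x i) (f' x).

Lemma upd_eq n (x : vec n) i u : upd x i u i = u.
Proof. by rewrite /upd eqxx. Qed.

Lemma upd_upd n (x : vec n) i u v : upd (upd x i u) i v = upd x i v.
Proof. by apply: functional_extensionality => j; rewrite /upd; case: (j == i). Qed.

Lemma upd_id n (x : vec n) i : upd x i (x i) = x.
Proof. by apply: functional_extensionality => j; rewrite /upd; case: eqP => [->|]. Qed.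

Lemma is_pderiv_upd n (i : 'I_n) f f' x u : is_pderiv i f f' ->
  der (fun v => f (upd x i v)) u (f' (upd x i u)).
Proof.
move=> h; have := h (upd x i u); rewrite upd_eq.
apply: is_derive_ext => v; by rewrite upd_upd.
Qed.

Lemma upd_vcons0 n u (x : vec n) v : upd (vcons u x) ord0 v = vcons v x.
Proof.
apply: functional_extensionality => j; rewrite /upd /vcons.
by case: unliftP => [k ->|->].
Qed.

Lemma upd_vcons_lift n u (x : vec n) k v :
  upd (vcons u x) (lift ord0 k) v = vcons u (upd x k v).
Proof.
apply: functional_extensionality => j; rewrite /upd /vcons.
by case: unliftP => [l ->|->].
Qed.

Lemma vcons_lift n u (x : vec n) k : vcons u x (lift ord0 k) = x k.
Proof. by rewrite /vcons liftK. Qed.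

Lemma vcons_ord0 n u (x : vec n) : vcons u x ord0 = u.
Proof. by rewrite /vcons unlift_none. Qed.

(** The derivative in the outermost variable can be pulled out of the inner
    integral, and then the fundamental theorem of calculus gives a difference
    of two values which agree by periodicity.  For an inner variable the
    induction hypothesis applies to each slice. *)
Lemma torus_int_pderiv0 n (k : 'I_n) (f f' : vec n -> C) :
  cont f -> cont f' -> is_pderiv k f f' ->
  (forall x, f (upd x k (x k + 2 * PI)) = f x) ->
  torus_int f' = RtoC 0.
Proof.
elim: n k f f' => [[] //|n IH] k f f' hf hf' hd hp /=.
case: (unliftP ord0 k) => [j|] ek; subst k.
  have -> : (fun u => torus_int (fun x => f' (vcons u x))) = fun _ => RtoC 0.
    apply: functional_extensionality => u.
    apply: (IH j (fun x => f (vcons u x))); try exact: cont_vcons_r.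
      move=> x; have := hd (vcons u x); rewrite vcons_lift.
      by apply: is_derive_ext => v; rewrite upd_vcons_lift.
    by move=> x; rewrite -(hp (vcons u x)) vcons_lift upd_vcons_lift.
  apply: (is_RInt_unique (V := C_R_CompleteNormedModule)).
  have := @is_RInt_const C_R_NormedModule 0 (2 * PI) (RtoC 0).
  by rewrite (scal_zero_r (V := C_R_NormedModule)).
apply: (is_RInt_unique (V := C_R_CompleteNormedModule)).
pose g u := torus_int (fun x => f (vcons u x)).
have g0 : g (2 * PI) = g 0.
  rewrite /g; congr torus_int; apply: functional_extensionality => x.
  by rewrite -(hp (vcons 0 x)) vcons_ord0 upd_vcons0 Rplus_0_l.
have := is_RInt_derive (V := C_R_CompleteNormedModule) g
  (fun u => torus_int (fun x => f' (vcons u x))) 0 (2 * PI).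
rewrite g0 (minus_eq_zero (G := C_R_NormedModule)).
apply=> u _; last exact: cont_torus_int_vcons.
apply: (der_torus_int (F := fun q => f (vcons q.1 q.2))
  (dF := fun q => f' (vcons q.1 q.2))); try exact: cont_vcons.
move=> v x /=; have := hd (vcons v x); rewrite vcons_ord0.
by apply: is_derive_ext => w; rewrite upd_vcons0.
Qed.

(** * Smooth functions and operators commuting with partial derivatives *)

Definition smooth n (f : vec n -> C) : Prop := forall k, Ck k f.

Lemma smooth_cont n (f : vec n -> C) : smooth f -> cont f.
Proof. by move=> h; have [] := h 0%N. Qed.

Lemma smooth_pderiv n (f : vec n -> C) i : smooth f -> smooth (pderiv i f).
Proof. by move=> h k; have [_ /(_ i) []] := h k.+1. Qed.

Lemma smooth_is_pderiv n (f : vec n -> C) i : smooth f -> is_pderiv i f (pderiv i f).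
Proof.
move=> h x; have [_ /(_ i) [/(_ x) [l hl] _]] := h 1%N.
have /der_ReIm [h1 h2] := hl : der _ _ _.
by apply/der_ReIm; split; apply: Derive_correct; [exists (Re l)|exists (Im l)].
Qed.

Lemma pderivE n (f f' : vec n -> C) i : is_pderiv i f f' -> pderiv i f = f'.
Proof.
move=> h; apply: functional_extensionality => x; rewrite /pderiv.
have /der_ReIm [h1 h2] := h x.
rewrite (is_derive_unique _ _ _ h1) (is_derive_unique _ _ _ h2).
by case: (f' x).
Qed.

(** An operator L that turns the derivative in direction g i into the one in
    direction i preserves smoothness.  Applied to the Fourier coefficient, where
    g includes the variables t among the variables (t, x). *)
Lemma smooth_intertwine n n' (L : (vec n -> C) -> vec n' -> C) (g : 'I_n' -> 'I_n) :
  (forall f, smooth f -> cont (L f)) ->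
  (forall f i, smooth f -> is_pderiv i (L f) (L (pderiv (g i) f))) ->
  forall f, smooth f -> smooth (L f).
Proof.
move=> hc hd f hf k; elim: k f hf => [|k IH] f hf; (split; first exact: hc) => //.
move=> i; split.
  by move=> x; eexists; apply: (hd f i hf x).
by rewrite (pderivE (hd f i hf)); apply: IH; exact: smooth_pderiv.
Qed.

Lemma smooth_iter n (f : vec n -> C) i p : smooth f -> smooth (iter p (pderiv i) f).
Proof. by move=> h; elim: p => //= p; exact: smooth_pderiv. Qed.

Lemma smooth_foldr n n' (f : vec n -> C) (g : 'I_n' -> 'I_n) (a : 'I_n' -> nat) l :
  smooth f -> smooth (foldr (fun i h => iter (a i) (pderiv (g i)) h) f l).
Proof. by move=> h; elim: l => //= i l; exact: smooth_iter. Qed.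

(** The same intertwining relation for mixed derivatives.  It serves both for
    Fourier coefficients and, with g the identity, for multiplication by a
    constant. *)
Lemma foldr_intertwine n n' (L : (vec n -> C) -> vec n' -> C) (g : 'I_n' -> 'I_n) :
  (forall f i, smooth f -> is_pderiv i (L f) (L (pderiv (g i) f))) ->
  forall (a : 'I_n' -> nat) l f, smooth f ->
  foldr (fun i h => iter (a i) (pderiv i) h) (L f) l =
  L (foldr (fun i h => iter (a i) (pderiv (g i)) h) f l).
Proof.
move=> hd a l f hf; elim: l => //= i l ->.
elim: (a i) => //= p ->.
by rewrite (pderivE (hd _ i _)) //; apply: smooth_iter; apply: smooth_foldr.
Qed.

Lemma der_scal c f x l : der f x l -> der (fun y => (c * f y)%C) x (c * l)%C.
Proof.
move=> h.
have h0 : der (fun _ => c) x 0 := is_derive_const (V := C_R_NormedModule) c x.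
have := der_mult h0 h.
by rewrite (_ : (0 * f x + c * l = c * l)%C) //; ring.
Qed.

Lemma is_pderiv_scal n c (f f' : vec n -> C) i :
  is_pderiv i f f' -> is_pderiv i (fun x => (c * f x)%C) (fun x => (c * f' x)%C).
Proof. by move=> h x; apply: der_scal; apply: h. Qed.

Lemma mderiv_scal n (a : 'I_n -> nat) c (f : vec n -> C) : smooth f ->
  mderiv a (fun x => (c * f x)%C) = (fun x => (c * mderiv a f x)%C).
Proof.
move=> hf.
apply: (foldr_intertwine (L := fun f x => (c * f x)%C) (g := id)) => // h i hh.
by apply: is_pderiv_scal; exact: smooth_is_pderiv.
Qed.

(** * The exponential waves exp(-i x.eta) *)

HB.instance Definition _ := Monoid.isComLaw.Build R 0 Rplus
  (fun x y z => esym (Rplus_assoc x y z)) Rplus_comm Rplus_0_l.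

Lemma dot_upd n (x : vec n) eta k u :
  dot (upd x k u) eta = dot x eta + (u - x k) * IZR (eta k).
Proof.
rewrite /dot (bigD1 k) //= [in RHS](bigD1 k) //= upd_eq.
rewrite (eq_bigr (fun i => x i * IZR (eta i))); first by ring.
by move=> i /negbTE ik; rewrite /upd ik.
Qed.

Lemma continuous_dot n eta (x : vec n) : continuous (fun y : vec n => dot y eta) x.
Proof.
rewrite /dot; elim: (index_enum _) => [|i s IH].
  apply: (continuous_ext (fun _ => 0)); last exact: continuous_const.
  by move=> y; rewrite big_nil.
apply: (continuous_ext (fun y : vec n => y i * IZR (eta i) +
    \big[Rplus/0]_(j <- s) (y j * IZR (eta j)))).
  by move=> y; rewrite big_cons.
apply: (continuous_plus (V := R_NormedModule)) => //.
apply: (continuous_mult (K := R_AbsRing)).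
  exact: continuous_coord.
exact: continuous_const.
Qed.

Definition wave n (eta : 'I_n -> Z) (x : vec n) : C := expi (- dot x eta).

Lemma Cmod_Ci : Cmod Ci = 1.
Proof. by rewrite /Cmod /= (_ : _ + _ = 1) ?sqrt_1 //; ring. Qed.

Lemma Cmod_expi u : Cmod (expi u) = 1.
Proof.
rewrite /Cmod (_ : _ + _ = 1) ?sqrt_1 //=.
have := sin2_cos2 u; rewrite /Rsqr; lra.
Qed.

Lemma cont_wave n (eta : 'I_n -> Z) : cont (wave eta).
Proof.
move=> x; apply: (continuous_comp (fun y : vec n => - dot y eta) expi).
  apply: (continuous_opp (V := R_NormedModule)); exact: continuous_dot.
apply/continuous_ReIm; split.
  exact: continuous_cos.
exact: continuous_sin.
Qed.

Lemma is_pderiv_wave n (eta : 'I_n -> Z) k :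
  is_pderiv k (wave eta) (fun x => (- (Ci * IZR (eta k)) * wave eta x)%C).
Proof.
move=> x; apply/der_ReIm; rewrite /wave /=; split.
- apply: (is_derive_ext (fun u => cos (- (dot x eta + (u - x k) * IZR (eta k))))).
    by move=> u; rewrite dot_upd.
  auto_derive => //.
  rewrite (_ : dot x eta + (x k + - x k) * _ = dot x eta); last by ring.
  by rewrite /Re /Im /=; ring.
- apply: (is_derive_ext (fun u => sin (- (dot x eta + (u - x k) * IZR (eta k))))).
    by move=> u; rewrite dot_upd.
  auto_derive => //.
  rewrite (_ : dot x eta + (x k + - x k) * _ = dot x eta); last by ring.
  by rewrite /Re /Im /=; ring.
Qed.

Lemma expi_period u (z : Z) : expi (u + IZR z * (2 * PI)) = expi u.
Proof.
have pos v (n : nat) : expi (v + INR n * (2 * PI)) = expi v.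
  rewrite /expi (_ : v + INR n * (2 * PI) = v + 2 * INR n * PI); last by ring.
  by rewrite cos_period sin_period.
have [hz|hz] := Z_le_gt_dec 0 z.
  by rewrite -[z]Z2Nat.id // -INR_IZR_INZ pos.
rewrite -(pos _ (Z.to_nat (- z))) INR_IZR_INZ Z2Nat.id; last by lia.
by rewrite opp_IZR; congr expi; ring.
Qed.

Lemma wave_period n (eta : 'I_n -> Z) k x :
  wave eta (upd x k (x k + 2 * PI)) = wave eta x.
Proof.
rewrite /wave dot_upd -[RHS](expi_period _ (- eta k)) opp_IZR.
by congr expi; ring.
Qed.

(** * Partial Fourier coefficients *)

Lemma upd_vjoin_l r s (t : vec r) (x : vec s) i u :
  vjoin (upd t i u) x = upd (vjoin t x) (lshift s i) u.
Proof.
apply: functional_extensionality => j; rewrite /vjoin /upd.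
by case: split_ordP => k ->; rewrite eq_shift.
Qed.

Lemma upd_vjoin_r r s (t : vec r) (x : vec s) i u :
  vjoin t (upd x i u) = upd (vjoin t x) (rshift r i) u.
Proof.
apply: functional_extensionality => j; rewrite /vjoin /upd.
by case: split_ordP => k ->; rewrite eq_shift.
Qed.

Lemma vjoin_l r s (t : vec r) (x : vec s) i : vjoin t x (lshift s i) = t i.
Proof. by rewrite /vjoin; case: split_ordP => k /eqP; rewrite eq_shift // => /eqP ->. Qed.

Lemma vjoin_r r s (t : vec r) (x : vec s) i : vjoin t x (rshift r i) = x i.
Proof. by rewrite /vjoin; case: split_ordP => k /eqP; rewrite eq_shift // => /eqP ->. Qed.

Lemma fourierE r s (phi : vec (r + s) -> C) t eta :
  fourier phi t eta = (RtoC (/ (2 * PI) ^ s) *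
    torus_int (fun x => phi (vjoin t x) * wave eta x))%C.
Proof. by []. Qed.

Lemma cont_integrand (T : UniformSpace) r s (phi : vec (r + s) -> C) eta
   (f : T -> vec r) :
  cont phi -> (forall t, continuous f t) ->
  cont (fun q : T * vec s => phi (vjoin (f q.1) q.2) * wave eta q.2)%C.
Proof.
move=> hphi hf; apply: cont_mult.
  apply: cont_comp hphi => q; apply: continuous_vjoin; last exact: continuous_snd.
  apply: continuous_comp => //; exact: continuous_fst.
apply: cont_comp (@cont_wave _ _) => q; exact: continuous_snd.
Qed.

Lemma cont_integrand_r r s (phi : vec (r + s) -> C) eta t :
  cont phi -> cont (fun x : vec s => phi (vjoin t x) * wave eta x)%C.
Proof.
move=> hphi; apply: cont_mult; last exact: cont_wave.
apply: cont_comp hphi => q.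
apply: continuous_vjoin; [exact: continuous_const|exact: continuous_id].
Qed.

Lemma cont_fourier r s (phi : vec (r + s) -> C) eta : cont phi ->
  cont (fun t => fourier phi t eta).
Proof.
move=> hphi; apply: cont_mult; first exact: cont_const.
apply: (cont_torus_int (F := fun q => (phi (vjoin q.1 q.2) * wave eta q.2)%C)).
have := @cont_integrand (vec r) r s phi eta (fun t => t) hphi.
by apply=> t; exact: continuous_id.
Qed.

(** With all coordinates of t but the i-th one frozen, this is differentiation
    of a torus integral in one real parameter. *)
Lemma is_pderiv_fourier r s (phi : vec (r + s) -> C) eta i : smooth phi ->
  is_pderiv i (fun t => fourier phi t eta)
    (fun t => fourier (pderiv (lshift s i) phi) t eta).
Proof.
move=> hphi t; apply: der_scal.
have hu v : continuous (U := vec r) (fun w : R => upd t i w) v.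
  apply: continuous_upd; [exact: continuous_const|exact: continuous_id].
have := der_torus_int
  (F := fun q => (phi (vjoin (upd t i q.1) q.2) * wave eta q.2)%C)
  (dF := fun q => (pderiv (lshift s i) phi (vjoin (upd t i q.1) q.2) * wave eta q.2)%C)
  _ _ _ (t i).
rewrite /= upd_id; apply.
- by apply: cont_integrand => //; exact: smooth_cont.
- by apply: cont_integrand => //; apply: smooth_cont; exact: smooth_pderiv.
- move=> v x /=.
  have := is_pderiv_upd (vjoin t x) v (smooth_is_pderiv (lshift s i) hphi).
  rewrite -upd_vjoin_l => /(der_scal (wave eta x)).
  rewrite Cmult_comm; apply: is_derive_ext => w.
  by rewrite upd_vjoin_l Cmult_comm.
Qed.

Lemma smooth_fourier r s (phi : vec (r + s) -> C) eta : smooth phi ->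
  smooth (fun t => fourier phi t eta).
Proof.
apply: (smooth_intertwine (L := fun f t => fourier f t eta) (g := lshift s)) => f.
  by move=> hf; apply: cont_fourier; exact: smooth_cont.
by move=> i; exact: is_pderiv_fourier.
Qed.

(** Integration by parts: the product of phi and the wave is periodic in x_k,
    so the integral of its derivative in x_k vanishes, and that derivative is
    expanded by the product rule. *)
Lemma fourier_pderiv_r r s (phi : vec (r + s) -> C) eta k t : smooth phi ->
  (forall x, phi (upd x (rshift r k) (x (rshift r k) + 2 * PI)) = phi x) ->
  fourier (pderiv (rshift r k) phi) t eta = (Ci * IZR (eta k) * fourier phi t eta)%C.
Proof.
move=> hphi hp; rewrite !fourierE.
have hc := smooth_cont hphi.
have hc' := smooth_cont (smooth_pderiv (rshift r k) hphi).
have c1 := cont_integrand_r (eta := eta) (t := t) hc'.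
have c2 := cont_mult (cont_const (c := (- (Ci * IZR (eta k)))%C))
  (cont_integrand_r (eta := eta) (t := t) hc).
have := torus_int_plus c1 c2.
rewrite torus_int_scal; last exact: cont_integrand_r.
rewrite (torus_int_pderiv0 (k := k) (f := fun x => (phi (vjoin t x) * wave eta x)%C)).
- set I1 := torus_int _; set I2 := torus_int _ => h.
  have -> : I1 = (Ci * IZR (eta k) * I2)%C.
    have -> : I1 = (I1 + - (Ci * IZR (eta k)) * I2 + Ci * IZR (eta k) * I2)%C by ring.
    by rewrite -h; ring.
  by ring.
- exact: cont_integrand_r.
- exact: (cont_plus c1 c2).
- move=> x.
  have d1 := is_pderiv_upd (vjoin t x) (x k) (smooth_is_pderiv (rshift r k) hphi).
  have d2 := is_pderiv_wave eta k x.
  have := der_mult d1 d2.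
  rewrite -upd_vjoin_r upd_id.
  rewrite (_ : (_ + _ * (_ * _) = pderiv (rshift r k) phi (vjoin t x) * wave eta x +
    - (Ci * IZR (eta k)) * (phi (vjoin t x) * wave eta x))%C); last by ring.
  by apply: is_derive_ext => v; rewrite upd_vjoin_r.
- by move=> x; rewrite wave_period upd_vjoin_r -{1}(vjoin_r t x k) hp.
Qed.

(** The difference quotients at x and at the translated point coincide term
    by term, hence so do their limits. *)
Lemma pderiv_periodic n (f : vec n -> C) i :
  (forall x, f (upd x i (x i + 2 * PI)) = f x) ->
  forall x, pderiv i f (upd x i (x i + 2 * PI)) = pderiv i f x.
Proof.
move=> hp x; rewrite /pderiv upd_eq.
have hs v : f (upd x i (v + 2 * PI)) = f (upd x i v).
  by rewrite -(hp (upd x i v)) upd_eq upd_upd.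
have D (p : C -> R) :
    Derive (fun u => p (f (upd (upd x i (x i + 2 * PI)) i u))) (x i + 2 * PI) =
    Derive (fun u => p (f (upd x i u))) (x i).
  rewrite /Derive; congr real; apply: Lim_ext => h.
  rewrite !upd_upd hs.
  by rewrite (_ : x i + 2 * PI + h = x i + h + 2 * PI) ?hs //; ring.
by rewrite !D.
Qed.

Lemma fourier_iter_pderiv_r r s (phi : vec (r + s) -> C) eta k p t : smooth phi ->
  (forall x, phi (upd x (rshift r k) (x (rshift r k) + 2 * PI)) = phi x) ->
  fourier (iter p (pderiv (rshift r k)) phi) t eta =
  ((Ci * IZR (eta k)) ^ p * fourier phi t eta)%C.
Proof.
move=> hphi hp; elim: p => [|p IH] /=; first by ring.
rewrite fourier_pderiv_r; last 2 first.
- exact: smooth_iter.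
- by elim: {IH} p => //= p IH; exact: pderiv_periodic.
by rewrite IH; ring.
Qed.

(** The factor (2 pi)^-s normalizes the torus to volume 1. *)
Lemma fourier_le r s (phi : vec (r + s) -> C) t eta M : cont phi ->
  (forall x, Cmod (phi x) <= M) -> Cmod (fourier phi t eta) <= M.
Proof.
move=> hphi hM; rewrite fourierE Cmod_mult Cmod_R.
have h2 : 0 < (2 * PI) ^ s by apply: pow_lt; have := PI_RGT_0; lra.
rewrite Rabs_pos_eq; last by apply/Rlt_le/Rinv_0_lt_compat.
apply: (Rmult_le_reg_l ((2 * PI) ^ s)) => //.
rewrite -Rmult_assoc Rinv_r ?Rmult_1_l; last by lra.
apply: torus_int_le; first exact: cont_integrand_r.
by move=> x; rewrite Cmod_mult Cmod_expi Rmult_1_r.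
Qed.

(** * Mixed derivatives of Fourier coefficients *)

Lemma enum_ord_add r s : enum 'I_(r + s) =
  map (@lshift r s) (enum 'I_r) ++ map (@rshift r s) (enum 'I_s).
Proof.
apply: (inj_map val_inj); rewrite map_cat val_enum_ord iotaD.
congr (_ ++ _).
  rewrite -[RHS](map_comp val (@lshift r s) (enum 'I_r)) -[LHS]val_enum_ord.
  exact: eq_map.
rewrite -[RHS](map_comp val (@rshift r s) (enum 'I_s)) add0n -[X in iota X]addn0 iotaDl.
rewrite -val_enum_ord -[LHS]map_comp.
exact: eq_map.
Qed.

(** The multi-index of d_t^a d_{x_k}^p in the variables (t, x). *)
Definition join_index r s (a : 'I_r -> nat) (k : 'I_s) (p : nat) (i : 'I_(r + s)) :=
  match split i with inl j => a j | inr j => if j == k then p else 0%N end.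

Lemma join_index_l r s a k p (i : 'I_r) : @join_index r s a k p (lshift s i) = a i.
Proof. by rewrite /join_index; case: split_ordP => j /eqP; rewrite eq_shift // => /eqP ->. Qed.

Lemma join_index_r r s a k p (i : 'I_s) :
  @join_index r s a k p (rshift r i) = if i == k then p else 0%N.
Proof. by rewrite /join_index; case: split_ordP => j /eqP; rewrite eq_shift // => /eqP ->. Qed.

Lemma mlen_join r s a k p : mlen (@join_index r s a k p) = (mlen a + p)%N.
Proof.
rewrite /mlen big_split_ord /=; congr (_ + _)%N.
  by apply: eq_bigr => i _; rewrite join_index_l.
rewrite (bigD1 k) //= join_index_r eqxx big1 ?addn0 // => i /negbTE ik.
by rewrite join_index_r ik.
Qed.

(** The enumeration of 'I_(r + s) lists the t-variables first, so [mderiv]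
    applies them outermost, after all derivatives in x. *)
Lemma mderiv_join r s a k p (f : vec (r + s) -> C) :
  mderiv (join_index a k p) f =
  foldr (fun i h => iter (a i) (pderiv (lshift s i)) h)
    (iter p (pderiv (rshift r k)) f) (enum 'I_r).
Proof.
have hr (l : seq 'I_s) : uniq l ->
    foldr (fun i h => iter (join_index a k p i) (pderiv i) h) f (map (@rshift r s) l) =
    if k \in l then iter p (pderiv (rshift r k)) f else f.
  elim: l => //= i l IH /andP [il /IH ->].
  rewrite join_index_r inE [k == i]eq_sym; case: eqP => [ik|_] //=.
  by rewrite -ik (negbTE il).
rewrite /mderiv enum_ord_add foldr_cat hr ?enum_uniq // mem_enum.
elim: (enum 'I_r) => //= i l IH.
by rewrite IH join_index_l.
Qed.

Lemma Cmod_mD n (a : 'I_n -> nat) f x : Cmod (mD a f x) = Cmod (mderiv a f x).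
Proof. by rewrite /mD Cmod_mult Cmod_pow Cmod_opp Cmod_Ci pow1 Rmult_1_l. Qed.

(** The factor (i eta_k)^p is a constant for the derivatives in t; moving it
    inside and absorbing it into the coefficient by integration by parts leaves
    the coefficient of d_t^a d_{x_k}^p phi. *)
Lemma mderiv_fourier_le r s (phi : vec (r + s) -> C) a k p eta t M :
  smooth_torus phi ->
  (forall x, Cmod (mderiv (join_index a k p) phi x) <= M) ->
  Rabs (IZR (eta k)) ^ p * Cmod (mderiv a (fun t' => fourier phi t' eta) t) <= M.
Proof.
move=> [hper hphi]; rewrite mderiv_join => hM.
have <- : Cmod ((Ci * IZR (eta k)) ^ p)%C = Rabs (IZR (eta k)) ^ p.
  by rewrite Cmod_pow Cmod_mult Cmod_R Cmod_Ci Rmult_1_l.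
rewrite -Cmod_mult.
have := mderiv_scal a ((Ci * IZR (eta k)) ^ p)%C (smooth_fourier eta hphi).
move=> /(f_equal (fun g => g t)) <-.
have -> : (fun t' => ((Ci * IZR (eta k)) ^ p * fourier phi t' eta)%C) =
    (fun t' => fourier (iter p (pderiv (rshift r k)) phi) t' eta).
  by apply: functional_extensionality => t'; rewrite fourier_iter_pderiv_r.
have hs := smooth_iter (rshift r k) p hphi.
rewrite /mderiv (foldr_intertwine (L := fun f t' => fourier f t' eta) (g := lshift s)) //.
  by apply: fourier_le => //; apply: smooth_cont; exact: smooth_foldr.
by move=> f i; exact: is_pderiv_fourier.
Qed.

(** * The elementary estimates *)

Lemma sum_le_size (I : Type) (l : seq I) (F : I -> R) M :
  (forall i, F i <= M) -> \big[Rplus/0]_(i <- l) F i <= INR (size l) * M.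
Proof.
move=> h; elim: l => [|i l IH]; first by rewrite big_nil Rmult_0_l; lra.
rewrite big_cons [size _]/= S_INR; have := h i; lra.
Qed.

(** Any k maximizing |eta_k| works; the factor s instead of its square root is
    wasteful but avoids a second square root. *)
Lemma enorm_le s (hs : (0 < s)%N) (eta : 'I_s -> Z) :
  exists k, enorm eta <= INR s * Rabs (IZR (eta k)).
Proof.
have [k _ hk] := arg_maxnP (fun i => Z.abs_nat (eta i)) (isT : xpredT (Ordinal hs)).
exists k; rewrite /enorm.
set A := Rabs _.
have A0 : 0 <= A by exact: Rabs_pos.
have s1 : 1 <= INR s by apply: (le_INR 1); apply/leP.
rewrite -(sqrt_pow2 (INR s * A)); last by apply: Rmult_le_pos; lra.
apply: sqrt_le_1_alt.
apply: (Rle_trans _ (INR s * A ^ 2)); last first.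
  rewrite Rpow_mult_distr; apply: Rmult_le_compat_r; first exact: pow2_ge_0.
  rewrite /= Rmult_1_r -{1}[INR s]Rmult_1_r; apply: Rmult_le_compat_l; lra.
have := sum_le_size (index_enum 'I_s) (F := fun i => IZR (eta i) ^ 2) (M := A ^ 2).
rewrite [size _](_ : _ = s); last by rewrite -[index_enum _]enumT size_enum_ord.
apply=> i; rewrite -pow2_abs; apply: pow_incr; split; first exact: Rabs_pos.
rewrite /A -!abs_IZR; apply: IZR_le.
have := hk i isT => /leP; lia.
Qed.

Lemma bin_le_exp2 n k : ('C(n, k) <= 2 ^ n)%N.
Proof.
elim: n k => [|n IH] [|k] //; first by rewrite bin0 expn_gt0.
by rewrite binS expnS mul2n -addnn leq_add.
Qed.

Lemma fact_add_le a b : INR (a + b)`! <= 2 ^ (a + b) * INR a`! * INR b`!.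
Proof.
have -> : 2 ^ (a + b)%N = INR (2 ^ (a + b))%N.
  by elim: (a + b)%N => //= n ->; rewrite expnS mult_INR.
rewrite -!mult_INR; apply: le_INR; apply/leP.
rewrite -(bin_fact (leq_addr b a)) addKn -[X in (_ <= X)%N]mulnA.
by rewrite leq_mul2r bin_le_exp2 orbT.
Qed.

(** Log-convexity makes the ratios m_(n+1) / m_n nondecreasing, and the first of
    them is m_1 / m_0 = 1. *)
Lemma weight_ge1 m : weight_sequence m -> forall n, 1 <= m n.
Proof.
move=> hm.
have mono n : m n <= m n.+1.
  elim: n => [|n IH]; first by rewrite (weight0 hm) (weight1 hm); lra.
  have h := weight_logconvex hm (isT : (1 <= n.+1)%N).
  have h1 := weight_gt0 hm n.+1; have h2 := weight_gt0 hm n.+2.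
  apply: (Rmult_le_reg_l (m n.+1)) => //.
  apply: (Rle_trans _ (m n * m n.+2)); first by move: h => /=; lra.
  by apply: Rmult_le_compat_r; lra.
elim=> [|n IH]; first by rewrite (weight0 hm); lra.
by have := mono n; lra.
Qed.

(** [real] sends the infinite values to 0, so it has to be excluded that the
    infimum is infinite: it lies between 0 and u_0. *)
Lemma le_Inf_seq (u : nat -> R) (X c : R) : 0 < c -> (forall n, 0 <= u n) ->
  (forall n, X <= c * u n) -> X <= c * real (Inf_seq (fun n => Rbar.Finite (u n))).
Proof.
move=> c0 u0 h.
have := Inf_seq_correct (fun n => Rbar.Finite (u n)).
case: (Inf_seq _) => [l| |] /= hl.
- have [//|hX] := Rle_lt_dec X (c * l).
  have e0 : 0 < X / c - l by apply: (Rmult_lt_reg_l c) => //; field_simplify; lra.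
  have [_ [n hn]] := hl (mkposreal _ e0); rewrite /= in hn.
  have := h n; have : c * u n < c * (X / c) by apply: Rmult_lt_compat_l; lra.
  rewrite (_ : c * (X / c) = X); last by field; lra.
  lra.
- by have := hl (u 0%N + 1) 0%N; lra.
- by have [n] := hl 0; have := u0 n; lra.
Qed.

(** * The decay estimate *)

Theorem theorem5p1 (m : nat -> R) (hm : weight_sequence m)
    (r s : nat) (hr : (0 < r)%N) (hs : (0 < s)%N)
    (phi : vec (r + s) -> C) (hphi : E_class m phi) :
  (forall eta : 'I_s -> Z, smooth_torus (fun t : vec r => fourier phi t eta)) /\
  exists C0 h delta : R, 0 < C0 /\ 0 < h /\ 0 < delta /\
    forall (t : vec r) (a : 'I_r -> nat) (eta : 'I_s -> Z),
      Cmod (mderiv a (fun t' : vec r => fourier phi t' eta) t) <=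
      C0 * h ^ mlen a * m (mlen a) * INR (mlen a)`! *
      real (Inf_seq (fun p : nat =>
        Rbar.Finite (m p * INR p`! / (delta ^ p * (1 + enorm eta) ^ p)))).
Proof.
have [hsm [C1 [h1 [C1_gt0 [h1_gt0 bound]]]]] := hphi.
have [hper hphi'] := hsm.
split.
  move=> eta; split; last exact: smooth_fourier.
  move=> i t; rewrite !fourierE; congr (_ * torus_int _)%C.
  apply: functional_extensionality => x.
  by rewrite upd_vjoin_l -{1}(vjoin_l t x i) hper.
have [H [H_gt1 hH]] := weight_moderate hm.
have m_gt0 := weight_gt0 hm.
have fact_gt0 n : 0 < INR n`! by apply: lt_0_INR; apply/ltP; exact: fact_gt0.
have fact_ge1 n : 1 <= INR n`! by apply: (le_INR 1); apply/leP; exact: ssrnat.fact_gt0.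
(* The p-th power of q collects the growth in p of the bound for d_t^a d_{x_k}^p phi:
   2 from the factorials, H from moderate growth, h1 from the class of phi. *)
pose q := 2 * h1 * H.
have q_gt0 : 0 < q by rewrite /q; apply: Rmult_lt_0_compat; lra.
have s_ge1 : 1 <= INR s by apply: (le_INR 1); apply/leP.
(* Below 1 for the sake of eta = 0, and at most 1 / (2 s q) for the others. *)
pose d := / (1 + 2 * INR s * q).
have sq_gt0 : 0 < 2 * INR s * q by apply: Rmult_lt_0_compat; lra.
have d_gt0 : 0 < d by apply: Rinv_0_lt_compat; lra.
have d_le1 : d <= 1.
  rewrite /d -[X in _ <= X]Rinv_1; apply: Rinv_le_contravar; lra.
exists C1, q, d; do 3!split => //.
move=> t a eta.
set X := Cmod _; set la := mlen a.
have X_ge0 : 0 <= X by exact: Cmod_ge_0.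
have enorm_ge0 : 0 <= enorm eta by exact: sqrt_pos.
have c_gt0 : 0 < C1 * q ^ la * m la * INR la`!.
  by repeat apply: Rmult_lt_0_compat => //; apply: pow_lt.
have den_gt0 p : 0 < d ^ p * (1 + enorm eta) ^ p.
  by apply: Rmult_lt_0_compat; apply: pow_lt; lra.
have [k hk] := enorm_le hs eta.
have est p : Rabs (IZR (eta k)) ^ p * X <=
    C1 * q ^ la * m la * INR la`! * (q ^ p * (m p * INR p`!)).
  rewrite /X; apply: (mderiv_fourier_le (k := k) (p := p) eta t hsm) => x.
  rewrite -Cmod_mD; apply: Rle_trans (bound _ _) _; rewrite mlen_join -/la.
  rewrite (_ : C1 * q ^ la * m la * INR la`! * (q ^ p * (m p * INR p`!)) =
    C1 * h1 ^ (la + p) * (H ^ (la + p) * m la * m p) *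
      (2 ^ (la + p) * INR la`! * INR p`!)); last first.
    have powD y : y ^ (la + p)%N = y ^ la * y ^ p by exact: pow_add.
    by rewrite /q !powD !Rpow_mult_distr; ring.
  have h_gt0 : 0 < h1 ^ (la + p) by apply: pow_lt.
  apply: Rmult_le_compat; last exact: fact_add_le.
  - by apply: Rlt_le; repeat apply: Rmult_lt_0_compat => //; apply: pow_lt.
  - exact: Rlt_le.
  - apply: Rmult_le_compat_l; last exact: hH.
    by apply: Rlt_le; apply: Rmult_lt_0_compat.
apply: le_Inf_seq => // p.
  apply: Rlt_le; apply: Rdiv_lt_0_compat => //.
  by apply: Rmult_lt_0_compat.
(* A largest coordinate equal to 0 forces eta = 0, where no decay is claimed. *)
have [eta0|eta_neq0] := Z.eq_dec (eta k) 0.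
  have en0 : enorm eta = 0 by move: hk; rewrite eta0 Rabs_R0 Rmult_0_r; lra.
  have := est 0%N; rewrite /= (weight0 hm) !Rmult_1_l !Rmult_1_r => e0.
  apply: (Rle_trans _ _ _ e0).
  rewrite -{1}[_ * INR la`!]Rmult_1_r; apply: Rmult_le_compat_l; first exact: Rlt_le.
  rewrite en0 Rplus_0_r pow1 Rmult_1_r.
  have dp : d ^ p <= 1 by rewrite -(pow1 p); apply: pow_incr; lra.
  have dp0 : 0 < d ^ p by exact: pow_lt.
  apply: (Rmult_le_reg_r (d ^ p)) => //.
  rewrite /Rdiv Rmult_assoc Rinv_l ?Rmult_1_r ?Rmult_1_l; last by lra.
  apply: Rle_trans dp _; rewrite -[X in X <= _]Rmult_1_l.
  have := weight_ge1 hm p; have := fact_ge1 p => f1 m1.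
  apply: Rmult_le_compat; lra.
set A := Rabs _ in hk est.
have A_ge1 : 1 <= A by rewrite /A -abs_IZR; apply: IZR_le; lia.
have A_gt0 : 0 < A ^ p by apply: pow_lt; lra.
apply: (Rmult_le_reg_l (A ^ p)) => //.
apply: Rle_trans (est p) _.
rewrite (_ : A ^ p * _ = C1 * q ^ la * m la * INR la`! *
  (A ^ p / (d ^ p * (1 + enorm eta) ^ p) * (m p * INR p`!))); last first.
  by rewrite /Rdiv; ring.
apply: Rmult_le_compat_l; first exact: Rlt_le.
apply: Rmult_le_compat_r; first by apply: Rlt_le; apply: Rmult_lt_0_compat.
apply: (Rmult_le_reg_r (d ^ p * (1 + enorm eta) ^ p)) => //.
rewrite /Rdiv [X in _ <= X]Rmult_assoc Rinv_l ?Rmult_1_r; last by have := den_gt0 p; lra.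
rewrite -!Rpow_mult_distr; apply: pow_incr; split.
  by apply: Rmult_le_pos; [lra|apply: Rmult_le_pos; lra].
(* Both 1 and |eta| are at most s A, so q d (1 + |eta|) <= q d 2 s A <= A. *)
apply: (Rle_trans _ (q * (d * (2 * INR s * A)))).
  apply: Rmult_le_compat_l; first lra.
  apply: Rmult_le_compat_l; first lra.
  have : 1 * 1 <= INR s * A by apply: Rmult_le_compat; lra.
  lra.
rewrite (_ : q * (d * (2 * INR s * A)) = A * (2 * INR s * q * d)); last by ring.
rewrite -[X in _ <= X]Rmult_1_r; apply: Rmult_le_compat_l; first lra.
apply: (Rmult_le_reg_r (1 + 2 * INR s * q)); first lra.
rewrite Rmult_assoc /d Rinv_l; lra.
Qed.
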